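(* Let $\mathcal{A}$ be a central, essential, supersolvable hyperplane arrangement in $\mathbb{R}^d$, let $F=\{X_i\}_{i=0}^d$ be a modular flag for $\mathcal{A}$, and let $c_0$ be any chamber incident to $F$. Then: (i) there is a unique minimal gallery $r_0$ from $c_0$ to $-c_0$ incident to $F$; (ii) this $r_0$ is an $L_2$-accessible vertex of the graph $G_2$ of minimal galleries from $c_0$ to $-c_0$, i.e. $d_{G_2}(r_0,r)=|L_2(r_0,r)|$ for every minimal gallery $r$ from $c_0$ to $-c_0$.
   Context: A central, essential arrangement $\mathcal{A}$ is a finite set of linear hyperplanes in $\mathbb{R}^d$ with common intersection $\{0\}$; $L_i$ is the set of codimension-$i$ intersections of its hyperplanes. Chambers are components of the complement; $L_1(c,c')$ is the set of hyperplanes separating $c,c'$. A minimal gallery is a shortest path in the graph on chambers with $c,c'$ adjacent iff $|L_1(c,c')|=1$; one from $c_0$ to $-c_0$ crosses every hyperplane exactly once and is determined by the crossing order. For such galleries $r,r'$, $L_2(r,r')$ is the set of $X\in L_2$ such that $r,r'$ cross the hyperplanes containing $X$ in different orders; $G_2$ has these galleries as vertices, $r,r'$ adjacent iff $|L_2(r,r')|=1$, and $d_{G_2}$ is its graph distance. A modular coatom is a line $\ell\in L_{d-1}$ such that for any distinct $H,H'\in\mathcal{A}$ not containing $\ell$, $\ell+(H\cap H')\in\mathcal{A}$. $\mathcal{A}$ is supersolvable if $d=1$ or it has a modular coatom $\ell$ with the localization $\mathcal{A}_\ell=\{H/\ell:H\supseteq\ell\}$ in $\mathbb{R}^d/\ell$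 supersolvable. A flag is a chain $\{0\}=X_0\subset\cdots\subset X_d=\mathbb{R}^d$ of intersection subspaces with $\dim X_i=i$; it is modular if $X_1$ is a modular coatom of $\mathcal{A}$ and each $X_i/X_{i-1}$ is a modular coatom of $\mathcal{A}_{X_{i-1}}$ (hyperplanes containing $X_{i-1}$, modulo $X_{i-1}$). A chamber is incident to a subspace $X$ if its closure meets $X$ in a set of dimension $\dim X$, and to $F$ if incident to every $X_i$. A minimal gallery from $c_0$ to $-c_0$ is incident to $F$ if whenever $i<j$ it crosses all hyperplanes containing $X_j$ before any hyperplane containing $X_i$ but not $X_j$. *)

(* Defs.v *)
From HB Require Import structures.
From mathcomp Require Import all_boot all_order all_algebra.
Set Implicit Arguments. Unset Strict Implicit. Unset Printing Implicit Defensive.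
Import Order.TTheory GRing.Theory Num.Theory.
Local Open Scope ring_scope.

Section Arrangement.
Variables (R : realFieldType) (d n : nat).

Variable a : 'I_n -> 'rV[R]_d.

(* Subspaces of R^d are represented (mxalgebra style) by the row space of a
   d x d matrix. *)
Definition hyp (i : 'I_n) : 'M[R]_d := kermx (a i)^T.

Definition flat (S : {set 'I_n}) : 'M[R]_d := (\bigcap_(i in S) hyp i)%MS.

Definition is_flat (Y : 'M[R]_d) : Prop := exists S, (Y == flat S)%MS.

Definition arrangement : Prop :=
  (forall i, a i != 0) /\ (forall i j, i != j -> ~~ (hyp i == hyp j)%MS).

Definition essential : Prop := \rank (flat setT) = 0%N.

(* Localization A_X in R^d / X is modelled through the lattice isomorphism
   between subspaces of R^d/X and subspaces of R^d containing X.
   [modular_coatom_rel X Y] : Y/X is a modular coatom of A_X. *)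
Definition modular_coatom_rel (X Y : 'M[R]_d) : Prop :=
  [/\ is_flat Y, (X <= Y)%MS, \rank Y = (\rank X).+1 &
   forall i j, i != j -> (X <= hyp i)%MS -> (X <= hyp j)%MS ->
     ~~ (Y <= hyp i)%MS -> ~~ (Y <= hyp j)%MS ->
     exists k, (X <= hyp k)%MS /\ ((Y + (hyp i :&: hyp j)) == hyp k)%MS].

(* [ss_from X k] : A_X (ambient dimension k = d - dim X) is supersolvable *)
Fixpoint ss_from (X : 'M[R]_d) (k : nat) : Prop :=
  match k with
  | 0 => False
  | 1 => True
  | k'.+1 => exists Y, modular_coatom_rel X Y /\ ss_from Y k'
  end.

Definition supersolvable : Prop := ss_from 0 d.

Definition modular_flag (X : nat -> 'M[R]_d) : Prop :=
  (forall i, (i <= d)%N -> is_flat (X i) /\ \rank (X i) = i) /\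
  (forall i, (0 < i <= d)%N -> modular_coatom_rel (X i.-1) (X i)).

(* Chambers are represented by their sign vectors: c i = true means the
   chamber lies on the positive side of H_i. *)
Definition chamb := {ffun 'I_n -> bool}.

Definition side (i : 'I_n) (x : 'rV[R]_d) : R := (x *m (a i)^T) ord0 ord0.

Definition is_chamber (c : chamb) : Prop :=
  exists x : 'rV[R]_d, forall i, if c i then 0 < side i x else side i x < 0.

Definition in_closure (c : chamb) (x : 'rV[R]_d) : Prop :=
  forall i, if c i then 0 <= side i x else side i x <= 0.

Definition chamb_opp (c : chamb) : chamb := [ffun i => ~~ c i].

Definition sep (c c' : chamb) : {set 'I_n} := [set i | c i != c' i].

Definition adj : rel chamb := fun c c' => #|sep c c'| == 1%N.

Definition gallery (c c' : chamb) (r : seq chamb) : Prop :=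
  exists t, [/\ r = c :: t, last c t = c', path adj c t &
                forall g, g \in r -> is_chamber g].

Definition min_gallery (c c' : chamb) (r : seq chamb) : Prop :=
  gallery c c' r /\ forall r', gallery c c' r' -> (size r <= size r')%N.

(* chamber incident to subspace X: closure(c) ∩ X has dimension dim X *)
Definition incident_sub (c : chamb) (X : 'M[R]_d) : Prop :=
  exists B : 'M[R]_d,
    (forall k, in_closure c (row k B) /\ (row k B <= X)%MS) /\ \rank B = \rank X.

Definition chamber_incident_flag (X : nat -> 'M[R]_d) (c : chamb) : Prop :=
  forall i, (i <= d)%N -> incident_sub c (X i).

Definition cross_time (r : seq chamb) (h : 'I_n) : nat :=
  find (fun p : chamb * chamb => p.1 h != p.2 h) (zip r (behead r)).

Definition gallery_incident_flag (X : nat -> 'M[R]_d) (r : seq chamb) : Prop :=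
  forall i j h h', (i < j <= d)%N -> (X j <= hyp h)%MS -> (X i <= hyp h')%MS ->
    ~~ (X j <= hyp h')%MS -> (cross_time r h < cross_time r h')%N.

Definition diff_order (r r' : seq chamb) (Y : 'M[R]_d) : bool :=
  [exists h, exists h', [&& (Y <= hyp h)%MS, (Y <= hyp h')%MS,
     (cross_time r h < cross_time r h')%N & (cross_time r' h' < cross_time r' h)%N]].

(* L_2(r,r') as a duplicate-free list of (canonical matrices of) subspaces *)
Definition L2 (r r' : seq chamb) : seq 'M[R]_d :=
  undup [seq <<flat s>>%MS | s <- enum {set 'I_n} &
           ((\rank (flat s)).+2 == d) && diff_order r r' (flat s)].

Definition L2card (r r' : seq chamb) : nat := size (L2 r r').

Definition G2walk (c0 : chamb) (r r' : seq chamb) (p : seq (seq chamb)) : Prop :=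
  exists t, [/\ p = r :: t, last r t = r', path (fun u v => L2card u v == 1%N) r t &
               forall u, u \in p -> min_gallery c0 (chamb_opp c0) u].

Definition G2dist_eq (c0 : chamb) (r r' : seq chamb) (k : nat) : Prop :=
  (exists p, G2walk c0 r r' p /\ size p = k.+1) /\
  (forall p, G2walk c0 r r' p -> (k.+1 <= size p)%N).

Definition L2_accessible (c0 : chamb) (r0 : seq chamb) : Prop :=
  forall r, min_gallery c0 (chamb_opp c0) r -> G2dist_eq c0 r0 r (L2card r0 r).

End Arrangement.

(* Main.v *)
(* Sign the linear forms so that they are positive on [c0]; a chamber is then the
   set of hyperplanes on which the form is negative, and a minimal gallery is an
   ordering of the hyperplanes.  The level of [h] is the largest [i] with
   [X i <= h]; incidence to the flag means that levels decrease along the gallery.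
   Modularity provides, for [h <> h'] of the same level, a hyperplane [k] of higher
   level whose form is [al h + be h'] with [al * be < 0], so the side of [k] tells
   which of [h] and [h'] is crossed first.  This gives uniqueness; existence comes
   from moving along the fibres over [X i.+1], in the direction of a face point.
   For accessibility, a gallery other than [r0] has a first level ascent [x b], and
   the hyperplanes of level [lev x] containing the flat [b :&: x] are crossed just
   before [b]; reversing the crossing of this flat removes exactly it from
   [L2(r0, r)]. *)
Require Import Defs.
From HB Require Import structures.
From mathcomp Require Import all_boot all_order all_algebra.
From mathcomp Require Import ring lra.
From mathcomp Require Import zify.
Set Implicit Arguments. Unset Strict Implicit. Unset Printing Implicit Defensive.
Import Order.TTheory GRing.Theory Num.Theory.
Local Open Scope ring_scope.

(** * Ordered-field preliminaries *)

Lemma eps_below (R : realFieldType) (I : finType) (P : pred I) (u : I -> R) :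
  (forall i, P i -> 0 < u i) -> exists2 e, 0 < e & forall i, P i -> e < u i.
Proof.
move=> uP; have [/existsP[i0 Pi0]|noP] := boolP [exists i, P i]; last first.
  exists 1 => // i Pi; case/negP: noP; apply/existsP; by exists i.
have [i Pi imin] := arg_minP u Pi0.
exists (u i / 2); first by have := uP i Pi; lra.
by move=> j Pj; have := uP i Pi; have := imin j Pj; lra.
Qed.

Lemma opp_coef_sign (R : realFieldType) (al be u v : R) :
  al * be < 0 -> u < 0 -> 0 < v -> (0 < al * u + be * v) = (0 < be).
Proof.
move=> ab u0 v0; have [b0|b0] := ltP 0 be; first by nra.
by apply/negbTE; rewrite -leNgt; nra.
Qed.

(** * Hyperplanes, their pairwise intersections and their linear forms *)

Section Hyperplanes.
Variables (R : realFieldType) (d n : nat) (a : 'I_n -> 'rV[R]_d).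
Hypothesis arrA : arrangement a.
Implicit Types (h k : 'I_n) (x : 'rV[R]_d).

Lemma sideD h x y : side a h (x + y) = side a h x + side a h y.
Proof. by rewrite /side mulmxDl mxE. Qed.

Lemma sideZ h t x : side a h (t *: x) = t * side a h x.
Proof. by rewrite /side -scalemxAl mxE. Qed.

Lemma sub_hyp h x : (x <= hyp a h)%MS = (side a h x == 0).
Proof.
apply/sub_kermxP/eqP => [|sx0]; first by rewrite /side => ->; rewrite mxE.
by apply/matrixP => i j; rewrite !ord1 [LHS]sx0 mxE.
Qed.

Lemma normal_nhyp h : ~~ (a h <= hyp a h)%MS.
Proof.
rewrite sub_hyp /side mxE; apply: contra (proj1 arrA h).
rewrite psumr_eq0 => [/allP ah0|i _]; last by rewrite mxE -expr2 sqr_ge0.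
apply/eqP/rowP => j; rewrite mxE; apply/eqP.
by have := ah0 j; rewrite mem_index_enum mxE mulf_eq0 orbb => /(_ isT).
Qed.

Lemma hyp_inj h k : (hyp a h <= hyp a k)%MS -> h = k.
Proof.
have rk i : \rank (hyp a i) = d.-1.
  by rewrite mxrank_ker mxrank_tr rank_rV (proj1 arrA) subn1.
move=> hk; apply/eqP/negPn/negP => /(proj2 arrA) /negP[].
by have [_] := mxrank_leqif_sup hk; rewrite hk !rk eqxx => <-.
Qed.

Lemma rank_hypI h k : h != k -> (\rank (hyp a h :&: hyp a k)%MS).+2 = d.
Proof.
move=> hk; have d0 : (0 < d)%N.
  have := proj1 arrA h; rewrite lt0n; apply: contraNneq => d0.
  by apply/eqP/matrixP => i j; have := ltn_ord j; lia.
have rk i : (\rank (hyp a i)).+1 = d.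
  by rewrite mxrank_ker mxrank_tr rank_rV (proj1 arrA) subn1 prednK.
have := mxrank_sum_cap (hyp a h) (hyp a k).
suff -> : \rank (hyp a h + hyp a k)%MS = d by have := rk h; have := rk k; lia.
have lt_hD : (\rank (hyp a h) < \rank (hyp a h + hyp a k)%MS)%N.
  rewrite (ltn_leqif (mxrank_leqif_sup (addsmxSl _ _))) addsmx_sub submx_refl /=.
  by apply: contra hk => /hyp_inj->.
by have := rank_leq_row (hyp a h + hyp a k)%MS; have := rk h; lia.
Qed.

(** Both intersections have codimension two, so an inclusion between them is an equality: such a
    flat is cut out by any two distinct hyperplanes containing it. *)
Lemma hypI_eq h h' k k' : h != h' -> k != k' ->
  (hyp a h :&: hyp a h' <= hyp a k)%MS -> (hyp a h :&: hyp a h' <= hyp a k')%MS ->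
  (hyp a k :&: hyp a k' <= hyp a h :&: hyp a h')%MS.
Proof.
move=> hh' kk' sk sk'.
have sI : (hyp a h :&: hyp a h' <= hyp a k :&: hyp a k')%MS by rewrite sub_capmx sk.
have : \rank (hyp a h :&: hyp a h')%MS == \rank (hyp a k :&: hyp a k')%MS.
  by have := rank_hypI hh'; have := rank_hypI kk'; lia.
by rewrite (mxrank_leqif_sup sI).
Qed.

(** Duality: the rows of [C^T] span the orthogonal complement of the two normals, hence lie in
    [hyp a k], so [a k] is in the span of [a h] and [a h']. *)
Lemma side_span h h' k : (hyp a h :&: hyp a h' <= hyp a k)%MS ->
  exists al be, forall x, side a k x = al * side a h x + be * side a h' x.
Proof.
move=> sk; pose C := cokermx (a h + a h')%MS.
have subC i : (a i <= a h + a h')%MS -> (C^T <= hyp a i)%MS.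
  move=> ai; apply/sub_kermxP; rewrite -trmx_mul.
  by move: ai; rewrite submxE => /eqP->; rewrite trmx0.
have /sub_kermxP : (C^T <= hyp a k)%MS.
  by apply: submx_trans sk; rewrite sub_capmx !subC ?addsmxSl ?addsmxSr.
rewrite -trmx_mul => /(congr1 trmx); rewrite trmxK trmx0 => /eqP.
rewrite -submxE => /sub_addsmxP[[u v] /= ak].
exists (u 0 0), (v 0 0) => x.
rewrite /side ak [u]mx11_scalar [v]mx11_scalar !mul_scalar_mx.
by rewrite linearD !linearZ /= mulmxDr -!scalemxAr !mxE /= ?mulr1n.
Qed.

End Hyperplanes.

(** * Galleries encoded as words of crossed hyperplanes *)

Section Words.
Variable n : nat.
Implicit Types (c : chamb n) (h : 'I_n) (w : seq 'I_n).

Definition flip c h : chamb n := [ffun k => c k (+) (k == h)].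

Definition word_gallery c w := c :: scanl flip c w.

Lemma foldl_flip c w h : foldl flip c w h = c h (+) odd (count_mem h w).
Proof.
elim: w c => [|k w IHw] c /=; first by rewrite addbF.
by rewrite IHw ffunE oddD oddb addbA [k == h]eq_sym.
Qed.

Lemma last_scanl_flip c w : last c (scanl flip c w) = foldl flip c w.
Proof. by elim: w c => //= h w IHw c. Qed.

Lemma sep_flip c h : sep c (flip c h) = [set h].
Proof. by apply/setP => k; rewrite !inE ffunE; case: (c k); case: (k == h). Qed.

Lemma word_path c w : path (@adj n) c (scanl flip c w).
Proof. by elim: w c => //= h w IHw c; rewrite IHw andbT /adj sep_flip cards1. Qed.

Lemma path_word c t : path (@adj n) c t -> exists w, t = scanl flip c w.
Proof.
elim: t c => [|c' t IHt] c /=; first by exists [::].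
case/andP => /cards1P[h sepE] /IHt[w ->].
have -> : c' = flip c h.
  apply/ffunP => k; rewrite ffunE; have /setP/(_ k) := sepE.
  by rewrite !inE; case: (c k); case: (c' k) => /= <-.
by exists (h :: w).
Qed.

Lemma mem_word_gallery c w c' :
  c' \in word_gallery c w <-> exists m, c' = foldl flip c (take m w).
Proof.
rewrite /word_gallery; elim: w c c' => [|h w IHw] c c' /=.
  by rewrite inE; split => [/eqP->|[m ->]//]; exists 0.
rewrite in_cons; split => [/predU1P[->|]|[[|m] -> /=]]; first by exists 0.
- by case/IHw => m ->; exists m.+1.
- by rewrite eqxx.
- by apply/orP; right; apply/IHw; exists m.
Qed.

(** For a letter absent from [w], both default values are [size w]. *)
Lemma cross_time_word c w h : cross_time (word_gallery c w) h = index h w.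
Proof.
rewrite /cross_time /word_gallery; elim: w c => //= k w IHw c.
rewrite ffunE [k == h]eq_sym; have [->|_] := eqVneq h k; first by case: (c k).
by rewrite addbF eqxx; congr _.+1; apply: IHw.
Qed.

End Words.

Arguments flip {n} c h.
Arguments word_gallery {n} c w.

(** * Sequences: final segments, first ascents and positions *)

Lemma pairwise_filter_cat (T : Type) (P : pred T) (s : seq T) :
  pairwise (fun x y => P x ==> P y) s -> s = filter (predC P) s ++ filter P s.
Proof.
elim: s => //= x s IHs /andP[xs /IHs {1}->]; case: (boolP (P x)) => [Px|] //=.
suff /all_filterP E : all P s.
  suff -> : filter (predC P) s = [::] by rewrite E.
  by rewrite -[in LHS]E -filter_predI; elim: {E} s {IHs xs} => //= y s ->; case: (P y).
by move: xs; apply: sub_all => y; rewrite Px.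
Qed.

Lemma unsorted_ascent (T : Type) (e : rel T) (s : seq T) : ~~ sorted e s ->
  exists p x y q, [/\ s = p ++ x :: y :: q, sorted e (rcons p x) & ~~ e x y].
Proof.
case: s => //= z s; elim: s z => //= y s IHs z; rewrite negb_and.
have [zy /= /IHs[p [x [y' [q [E pS nxy]]]]]|nzy _] := boolP (e z y); last first.
  by exists [::], z, y, s.
exists (z :: p), x, y', q; split; rewrite ?E //=.
by case: p E pS => [|y0 p] /= [<- _]; rewrite ?zy.
Qed.

Lemma uniq_pairwise (T : eqType) (e : rel T) (s : seq T) : uniq s ->
  {in s &, forall x y, (index x s < index y s)%N -> e x y} -> pairwise e s.
Proof.
case: s => // x0 s us es; apply/(pairwiseP x0) => i j; rewrite !inE => si sj ij.
by apply: es; rewrite ?mem_nth // !index_uniq.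
Qed.

Lemma sorted_index_eq (T : eqType) (s s' : seq T) : uniq s -> uniq s' -> s =i s' ->
  {in s &, forall x y, index x s < index y s -> index x s' < index y s'}%N -> s = s'.
Proof.
move=> us us' E lt_s.
have tr : transitive (fun x y : T => index x s' < index y s')%N.
  by move=> y x z; apply: ltn_trans.
apply: (irr_sorted_eq tr) => //; first by move=> x /=; rewrite ltnn.
  by apply: pairwise_sorted; apply: uniq_pairwise.
by apply: pairwise_sorted; apply: uniq_pairwise.
Qed.

Lemma index_before (T : eqType) (s t : seq T) x y :
  uniq (s ++ y :: t) -> x \in s -> (index x (s ++ y :: t) < index y (s ++ y :: t))%N.
Proof.
rewrite cat_uniq => /and3P[_ /norP[/negbTE ys _] _] xs.
by rewrite !index_cat xs ys /= eqxx addn0 index_mem.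
Qed.

Lemma index_after (T : eqType) (s t : seq T) x y :
  uniq (s ++ y :: t) -> x \in t -> (index y (s ++ y :: t) < index x (s ++ y :: t))%N.
Proof.
rewrite cat_uniq /= negb_or => /and3P[_ /andP[/negbTE ys /hasPn tS] /andP[yt _]] xt.
rewrite !index_cat ys (negbTE (tS _ xt)) ltn_add2l /= eqxx.
by case: eqVneq yt => // ->; rewrite xt.
Qed.

(** Letters outside the block keep their positions and those of the block stay in the same range of
    positions, so only two letters of the block can be exchanged. *)
Lemma index_swap_mem (T : eqType) (s m m' t : seq T) x y :
  m =i m' -> size m = size m' ->
  (index x (s ++ m ++ t) < index y (s ++ m ++ t))%N ->
  (index y (s ++ m' ++ t) < index x (s ++ m' ++ t))%N -> (x \in m) && (y \in m).
Proof.
move=> E sz; rewrite !index_cat -!E sz.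
have mem (z : T) (u : seq T) : (z \in u) = (index z u < size u)%N :> bool by rewrite index_mem.
have := mem x s; have := mem y s; have := mem x m; have := mem y m.
have := mem x m'; have := mem y m'; rewrite -!E sz.
case: (x \in s) (y \in s) (x \in m) (y \in m) => [] [] [] [] //=; lia.
Qed.

(** * Signed forms, levels and face points *)

Section Flag.
Variables (R : realFieldType) (d n : nat) (a : 'I_n -> 'rV[R]_d).
Variables (X : nat -> 'M[R]_d) (c0 : chamb n).
Hypotheses (arrA : arrangement a) (flagX : modular_flag a X).
Hypotheses (chc0 : is_chamber a c0) (incX : chamber_incident_flag a X c0).
Implicit Types (h k f : 'I_n) (x : 'rV[R]_d) (s w : seq 'I_n).

Definition sform h x : R := (-1) ^+ (~~ c0 h) * side a h x.

Lemma sformD h x y : sform h (x + y) = sform h x + sform h y.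
Proof. by rewrite /sform sideD mulrDr. Qed.

Lemma sformZ h t x : sform h (t *: x) = t * sform h x.
Proof. by rewrite /sform sideZ mulrCA. Qed.

Lemma sform_eq0 h x : (sform h x == 0) = (x <= hyp a h)%MS.
Proof. by rewrite sub_hyp /sform mulf_eq0 signr_eq0. Qed.

Lemma sform_signP (b : bool) h x :
  (if b then sform h x < 0 else 0 < sform h x) <->
  (if c0 h (+) b then 0 < side a h x else side a h x < 0).
Proof.
by rewrite /sform; case: (c0 h) b => [] [] /=;
  rewrite ?expr0 ?expr1 ?mul1r ?mulN1r ?oppr_lt0 ?oppr_gt0.
Qed.

Lemma sform_span h h' k : (hyp a h :&: hyp a h' <= hyp a k)%MS ->
  exists al be, forall x, sform k x = al * sform h x + be * sform h' x.
Proof.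
case/side_span => al [be E].
exists ((-1) ^+ (~~ c0 k) * al * (-1) ^+ (~~ c0 h)).
exists ((-1) ^+ (~~ c0 k) * be * (-1) ^+ (~~ c0 h')) => x.
rewrite /sform E mulrDr.
have sgn (b : bool) u v z : u * v * (-1) ^+ b * ((-1) ^+ b * z) = u * (v * z) :> R.
  by rewrite mulrA -(mulrA (u * v)) -expr2 sqrr_sign mulr1 mulrA.
by rewrite !sgn.
Qed.

Definition lev h : nat := \max_(i < d.+1 | (X i <= hyp a h)%MS) i.

Lemma flag_mono i j : (i <= j <= d)%N -> (X i <= X j)%MS.
Proof.
case/andP; elim: j => [|j IHj]; first by rewrite leqn0 => /eqP->.
rewrite leq_eqVlt => /predU1P[-> //|ij] jd.
have [_ /(_ j.+1)] := flagX; rewrite jd => /(_ isT)[_ + _ _].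
by apply: submx_trans; apply: IHj; lia.
Qed.

(** [X 0] is null, so the maximum is taken over a nonempty set and is attained; monotonicity of the
    flag gives the smaller indices. *)
Lemma lev_leq i h : (i <= d)%N -> (i <= lev h)%N = (X i <= hyp a h)%MS.
Proof.
move=> id; apply/idP/idP => [|Xi]; last first.
  by apply: (@leq_bigmax_cond _ _ _ (Ordinal (id : (i < d.+1)%N))).
have X0 : (X 0 <= hyp a h)%MS.
  have [_ /eqP] := proj1 flagX 0 (leq0n d).
  by rewrite mxrank_eq0 => /eqP->; rewrite sub0mx.
pose P := [pred j : 'I_d.+1 | (X j <= hyp a h)%MS].
have P_gt0 : (0 < #|P|)%N by apply/card_gt0P; exists ord0.
have [j Xj Ej] := eq_bigmax_cond (@nat_of_ord _) P_gt0.
rewrite /lev -[X in (_ <= X)%N]/(\max_(i in P) i) Ej => ij.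
by apply: submx_trans Xj; apply: flag_mono; rewrite ij -ltnS /=.
Qed.

Lemma lev_lt h : (lev h < d)%N.
Proof.
rewrite ltnNge; apply/negP; rewrite lev_leq // => Xh.
have [_ rkX] := proj1 flagX d (leqnn d).
have full : row_full (X d) by rewrite /row_full rkX.
by case/negP: (normal_nhyp arrA h); apply: submx_trans Xh; apply: submx_full.
Qed.

(** The rows of [B] span [X i] and every signed form is nonnegative on them. Their sum is a relative
    interior point of the face: a form vanishing there vanishes on each row, hence on [X i]. *)
Lemma face_point i : (i <= d)%N -> exists p, forall h,
  if (i <= lev h)%N then sform h p = 0 else 0 < sform h p.
Proof.
move=> id; have [B [Bcl rkB]] := incX id.
have BX : (B <= X i)%MS by apply/row_subP => k; have [] := Bcl k.
have XB : (X i <= B)%MS by rewrite -(mxrank_leqif_sup BX) rkB.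
exists (\sum_k row k B) => h.
have sum_sform : sform h (\sum_k row k B) = \sum_k sform h (row k B).
  by apply: (big_morph (sform h) (sformD h)); apply/eqP; rewrite sform_eq0 sub0mx.
have ge0 (j : 'I_d) : 0 <= sform h (row j B).
  have [/(_ h) + _] := Bcl j; rewrite /sform.
  by case: (c0 h); rewrite ?expr0 ?expr1 ?mul1r ?mulN1r ?oppr_ge0.
rewrite sum_sform lev_leq //; case: ifPn => Xh.
  apply: big1 => j _; apply/eqP; rewrite sform_eq0.
  by have [_ BjX] := Bcl j; apply: submx_trans Xh.
rewrite lt_neqAle sumr_ge0 // andbT eq_sym; apply: contra Xh.
rewrite psumr_eq0 // => /allP sf0; apply: submx_trans XB _.
apply/row_subP => k; rewrite -sform_eq0.
by have := sf0 k; rewrite mem_index_enum => /(_ isT).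
Qed.

(* Modularity of [X i.+1] over [X i]: the hyperplane [k] is
   [X i.+1 + (hyp f :&: hyp f')], and the opposite signs come from evaluating
   at the face point of [X i.+1], where [sform k] vanishes. *)
Lemma modular_form f f' : f != f' -> lev f = lev f' ->
  exists k al be, [/\ (lev f < lev k)%N, (hyp a f :&: hyp a f' <= hyp a k)%MS,
    al * be < 0 & forall x, sform k x = al * sform f x + be * sform f' x].
Proof.
move=> ff' lff'; have fd := lev_lt f; set i := lev f in lff' fd *.
have [_ /(_ i.+1)] := flagX; rewrite fd => /(_ isT)[_ _ _ modX].
have levE h : lev h = i -> (X i <= hyp a h)%MS && ~~ (X i.+1 <= hyp a h)%MS.
  by move=> hi; rewrite -!lev_leq ?hi ?leqnn ?ltnn // ltnW.
have /andP[Xf nXf] := levE f erefl; have /andP[Xf' nXf'] := levE f' (esym lff').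
have [k [_ /eqmxP Ek]] := modX _ _ ff' Xf Xf' nXf nXf'.
have lk : (i < lev k)%N by rewrite lev_leq // -Ek addsmxSl.
have sk : (hyp a f :&: hyp a f' <= hyp a k)%MS by rewrite -Ek addsmxSr.
have [al [be E]] := sform_span sk.
exists k, al, be; split => //.
have [p pP] := face_point fd.
have := pP f; have := pP f'; have := pP k; rewrite lk -lff' ltnn E => k0 f'0 f0.
have kN0 : (al != 0) || (be != 0).
  have := normal_nhyp arrA k; apply: contraR; rewrite negb_or !negbK.
  by case/andP => /eqP al0 /eqP be0; rewrite -sform_eq0 E al0 be0 !mul0r addr0.
have al_eq : al * sform f p = - (be * sform f' p) by apply/eqP; rewrite -addr_eq0 k0.
(* Multiplied by [sform f p > 0], the product [al * be] becomes [- be ^+ 2 * sform f' p]; if [be]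
   were zero, [al] would be zero too. *)
rewrite -(pmulr_llt0 _ f0) mulrAC al_eq mulNr oppr_lt0 mulrAC -expr2.
rewrite pmulr_lgt0 // exprn_even_gt0 //=; apply: contraTneq kN0 => be0.
rewrite be0 eqxx orbF negbK; move: al_eq; rewrite be0 mul0r oppr0.
by move/eqP; rewrite mulf_eq0 (gt_eqF f0) orbF.
Qed.

(** * Sets of hyperplanes separating [c0] from a chamber *)

Definition realizable s : Prop :=
  exists x, forall h, if h \in s then sform h x < 0 else 0 < sform h x.

Lemma realizable_eq s s' : s =i s' -> realizable s -> realizable s'.
Proof. by move=> E [x xP]; exists x => h; rewrite -E. Qed.

(** When exactly one of [f] and [f'] has been crossed, the two terms of the form of [k] have the
    same sign, because [al * be < 0]. The bit [e] depends only on the pair, so different galleries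
    can be compared through [k]. *)
Lemma modular_side f f' : f != f' -> lev f = lev f' ->
  exists k e, [/\ (lev f < lev k)%N, (hyp a f :&: hyp a f' <= hyp a k)%MS &
    forall s, realizable s -> (f \in s) != (f' \in s) -> (k \in s) = e (+) (f \in s)].
Proof.
move=> ff' lff'; have [k [al [be [lk sk ab E]]]] := modular_form ff' lff'.
exists k, (0 < be); split => // s [x xP]; have := xP f; have := xP f'; have := xP k.
have sgn u v := opp_coef_sign (u := u) (v := v) ab.
rewrite E; case: (f \in s) (f' \in s) => [] [] //= + f'x fx _.
  have := sgn _ _ fx f'x; case: (k \in s) => /= <-; first by move=> /lt_gtF->.
  by move->.
have := sgn (- sform f x) (- sform f' x).
rewrite !oppr_lt0 !oppr_gt0 !mulrN -opprD oppr_gt0 => /(_ fx f'x).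
by case: (k \in s) => /= <-; [move-> | move=> /lt_gtF->].
Qed.

(* Translating far in the direction of a face point of [X i] restores the side
   of [c0] for every hyperplane that does not contain [X i]. *)
Lemma realizable_localize i s : (i <= d)%N -> realizable s ->
  realizable [seq h <- s | i <= lev h]%N.
Proof.
move=> id [x xP]; have [p pP] := face_point id.
have [|e e0 eP] := @eps_below _ _ (fun h => lev h < i)%N
    (fun h => sform h p / (1 + `|sform h x|)).
  move=> h hi; have := pP h; rewrite leqNgt hi /= => p0.
  by rewrite divr_gt0 // ltr_pwDl.
exists (e *: x + p) => h; rewrite mem_filter sformD sformZ.
have := pP h; have := xP h; case: leqP => /= hi.
  move=> + -> ; rewrite addr0; case: (h \in s) => hx.
    by rewrite pmulr_rlt0.
  by rewrite pmulr_rgt0.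
move=> _ p0; have := eP h hi; rewrite ltr_pdivlMr; last by rewrite ltr_pwDl.
have : 0 <= e * (sform h x + `|sform h x|).
  by rewrite mulr_ge0 ?(ltW e0) // -lerBlDl sub0r -normrN ler_norm.
by rewrite !mulrDr mulr1; lra.
Qed.

(** Move from [x] in the direction of a face point of [X i.+1]: forms of level above [i] are
    constant and the others increase. The element [h] is the first of level [i] to leave [s]. *)
Lemma realizable_peel i s h0 : (i < d)%N -> realizable s ->
  (forall h, h \in s -> i <= lev h)%N -> h0 \in s -> lev h0 = i ->
  exists h, [/\ h \in s, lev h = i & realizable [seq f <- s | f != h]].
Proof.
move=> id [x xP] slev h0s h0i; have [p pP] := face_point id.
have p_gt0 f : (lev f <= i)%N -> 0 < sform f p by move=> fi; have := pP f; rewrite leqNgt ltnS fi.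
(* The time at which the moving point meets [hyp a f]. *)
pose t f := - sform f x / sform f p.
have tE f u : (lev f <= i)%N -> sform f (x + u *: p) = sform f p * (u - t f).
  by move=> /p_gt0 p0; rewrite sformD sformZ /t; field; rewrite gt_eqF.
pose P := [pred f | (f \in s) && (lev f == i)].
have Ph0 : P h0 by rewrite /= h0s h0i eqxx.
case: (arg_minP t Ph0) => h /andP[hs /eqP hi] hmin.
have t_gt f : P f && (f != h) -> 0 < t f - t h.
  case/andP=> Pf fh; rewrite subr_gt0 lt_neqAle hmin // andbT.
  have /andP[fs /eqP fi] := Pf.
  have [||k [al [be [lk sk _ E]]]] := @modular_form h f; rewrite ?hi ?fi // 1?eq_sym //.
  (* If [h] and [f] were met together, the form of [k] would vanish at that point; but [k] has level
     above [i], so its form keeps its nonzero value at [x]. *)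
  apply/eqP => tt; have := E (x + t h *: p).
  rewrite (tE h) ?hi // (tE f) ?fi // tt subrr !mulr0 !addr0.
  rewrite sformD sformZ; have := pP k; rewrite -hi lk => ->; rewrite mulr0 addr0 => k0.
  by have := xP k; rewrite k0 ltxx; case: ifP.
have [e e0 eP] := eps_below t_gt.
exists h; split => //; exists (x + (t h + e) *: p) => f; rewrite mem_filter.
have [fi|fi] := leqP (lev f) i; last first.
  have := pP f; rewrite fi sformD sformZ => ->; rewrite mulr0 addr0.
  suff -> : f != h by have := xP f.
  by apply: contraTneq fi => ->; rewrite hi ltnn.
rewrite tE //; have p0 := p_gt0 f fi.
have th_gt0 : 0 < t h.
  by rewrite /t divr_gt0 ?p_gt0 ?hi // oppr_gt0; have := xP h; rewrite hs.
have [fh|fh] /= := eqVneq f h; first by rewrite fh pmulr_rgt0 -?fh //; lra.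
have := xP f; case: ifPn => fs fx.
  have fi' : lev f == i by rewrite eqn_leq fi slev.
  have := eP f; rewrite /= fs fi' fh => /(_ isT).
  by rewrite pmulr_rlt0 //; lra.
have : t f < 0 by rewrite /t mulNr oppr_lt0 divr_gt0.
by rewrite pmulr_rgt0 //; lra.
Qed.

(** Peel off the hyperplanes of level [i] one at a time and read the process backwards: the one
    peeled first is crossed last, whence [rcons g h]. *)
Lemma realizable_chain i s : (i < d)%N -> realizable s ->
  (forall h, h \in s -> i <= lev h)%N ->
  exists g, [/\ uniq g, g =i [seq h <- s | lev h == i] &
    forall m, realizable ([seq h <- s | i < lev h]%N ++ take m g)].
Proof.
move=> id; have [m] := ubnP (size [seq h <- s | lev h == i]).
elim: m s => // m IHm s sz rs slev.
have [h0s|] := boolP (has (fun h => lev h == i) s); last first.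
  move=> /hasPn no; have sE : [seq h <- s | i < lev h]%N = s.
    by apply/all_filterP/allP => h hs; rewrite ltn_neqAle eq_sym no // slev.
  exists [::]; split => // [h|j]; last by rewrite cats0 sE.
  by rewrite mem_filter in_nil; apply/esym/andP => -[/eqP hi /no]; rewrite hi eqxx.
have [h0 hs0 /eqP hi0] := hasP h0s.
have [h [hs hi rh]] := realizable_peel id rs slev hs0 hi0.
have [||g [ug gE gr]] := IHm _ _ rh.
- rewrite -filter_predI (eq_filter (a2 := predI (fun f => f != h) (fun f => lev f == i))).
    have := count_predC (fun f => f != h) [seq f <- s | lev f == i].
    have : has (predC (fun f => f != h)) [seq f <- s | lev f == i].
      by apply/hasP; exists h; rewrite ?mem_filter ?hi ?eqxx //= eqxx.
    by rewrite has_count filter_predI [X in (X < m)%N]size_filter; lia.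
  by move=> f /=; rewrite andbC.
- by move=> f; rewrite mem_filter => /andP[_ /slev].
have hg : h \notin g by rewrite gE !mem_filter eqxx /= andbF.
have gE' : rcons g h =i [seq f <- s | lev f == i].
  move=> f; rewrite mem_rcons inE gE !mem_filter.
  by have [->|] := eqVneq f h; rewrite ?hi ?hs ?eqxx.
exists (rcons g h); split; rewrite ?rcons_uniq ?hg // => j.
have [js|js] := leqP j (size g).
  rewrite -cats1 takel_cat //; apply: realizable_eq (gr j) => f.
  rewrite !mem_cat !mem_filter; have [->|//] := eqVneq f h.
  by rewrite hi ltnn.
rewrite take_oversize ?size_rcons //; apply: realizable_eq rs => f.
rewrite mem_cat gE' !mem_filter; case fs: (f \in s); rewrite ?andbF // !andbT.
by have := slev f fs; rewrite leq_eqVlt eq_sym orbC => ->.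
Qed.


(** * Minimal galleries as crossing words; existence and uniqueness of the sorted one *)

Definition crossing_word w : Prop :=
  [/\ uniq w, forall h, h \in w & forall m, realizable (take m w)].

Definition geq_lev : rel 'I_n := fun h h' => (lev h' <= lev h)%N.

Lemma geq_lev_trans : transitive geq_lev.
Proof. by move=> k h f hk kf; apply: leq_trans kf hk. Qed.

Lemma chamber_foldl s : uniq s -> is_chamber a (foldl flip c0 s) <-> realizable s.
Proof.
move=> us; have E h : foldl flip c0 s h = c0 h (+) (h \in s).
  by rewrite foldl_flip count_uniq_mem // oddb.
by split=> -[x xP]; exists x => h; have := xP h; rewrite E; case: (sform_signP (h \in s) h x).
Qed.

Lemma gallery_word r : gallery a c0 (chamb_opp c0) r ->
  exists w, [/\ r = word_gallery c0 w, forall h, h \in w &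
    forall m, is_chamber a (foldl flip c0 (take m w))].
Proof.
case=> t [-> tl /path_word[w tE] tch]; exists w; rewrite {1}tE; split => // [h|m].
  have /ffunP/(_ h) : foldl flip c0 w = chamb_opp c0 by rewrite -tl tE last_scanl_flip.
  rewrite foldl_flip ffunE; apply: contraPT => /count_memPn->.
  by rewrite addbF; case: (c0 h).
by apply: tch; rewrite tE; apply/mem_word_gallery; exists m.
Qed.

Lemma crossing_word_gallery w : crossing_word w ->
  gallery a c0 (chamb_opp c0) (word_gallery c0 w).
Proof.
case=> uw aw rw; exists (scanl flip c0 w); split => //.
- rewrite last_scanl_flip; apply/ffunP => h.
  by rewrite foldl_flip count_uniq_mem // aw ffunE addbT.
- exact: word_path.
- by move=> g /mem_word_gallery[m ->]; apply/chamber_foldl; rewrite ?take_uniq.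
Qed.

Lemma size_crossing_word w : crossing_word w -> size w = n.
Proof.
case=> uw aw _; rewrite -[RHS]size_enum_ord; apply/eqP.
rewrite eqn_leq !uniq_leq_size ?enum_uniq // => h _.
by rewrite mem_enum.
Qed.

(** Descending induction on [i], starting at [d], which no level reaches. The word for levels above
    [j] is followed by a chain of level [j] that ends at the localization of the chamber opposite to
    [c0]. *)
Lemma sorted_word_above i : (i <= d)%N -> exists w,
  [/\ uniq w, forall h, (h \in w) = (i <= lev h)%N, sorted geq_lev w &
    forall m, realizable (take m w)].
Proof.
have [s0 s0E real_all] : exists2 s, forall h, h \in s & realizable s.
  have [x xP] := chc0; exists (enum 'I_n) => [h|]; first by rewrite mem_enum.
  exists (- x) => h; rewrite mem_enum inE.
  apply/(sform_signP true); have := xP h.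
  by rewrite -scaleN1r sideZ mulN1r; case: (c0 h); rewrite /= ?oppr_gt0 ?oppr_lt0.
move=> id; rewrite -(subKn id); elim: (d - i)%N (leq_subr i d) => [_|m IHm md].
  exists [::]; rewrite subn0; split => // [h|m]; first by rewrite leqNgt lev_lt.
  have [x xP] := chc0; exists x => h; apply/(sform_signP false).
  by have := xP h; rewrite addbF.
have [w [uw wE sw rw]] := IHm (ltnW md); set j := (d - m.+1)%N.
have jE : (d - m = j.+1)%N by rewrite /j; lia.
have jd : (j < d)%N by lia.
have [|g [ug gE gr]] := realizable_chain jd (realizable_localize (ltnW jd) real_all).
  by move=> h; rewrite mem_filter => /andP[].
have gE' h : (h \in g) = (lev h == j).
  by rewrite gE !mem_filter s0E andbT; case: eqP => // ->; rewrite leqnn.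
have wE' h : (h \in w) = (j < lev h)%N by rewrite wE jE.
exists (w ++ g); split=> [|h||l].
- rewrite cat_uniq uw ug andbT; apply/hasPn => h; rewrite gE' wE' => /eqP->.
  by rewrite ltnn.
- by rewrite mem_cat gE' wE'; case: ltngtP.
- rewrite (sorted_pairwise geq_lev_trans) pairwise_cat.
  rewrite -(sorted_pairwise geq_lev_trans) sw /=; apply/andP; split.
    apply/allrelP => h f; rewrite wE' gE' => jh /eqP fj.
    by rewrite /geq_lev fj ltnW.
  rewrite -(@eq_in_pairwise _ (mem g) (fun _ _ => true)) ?allss //.
    by elim: {gr gE gE' ug} g => //= ? g ->; rewrite all_predT.
  by move=> h f /=; rewrite !gE' /geq_lev => /eqP-> /eqP->; rewrite leqnn.
- rewrite take_cat; case: ltnP => _; first exact: rw.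
  apply: realizable_eq (gr (l - size w)%N) => h; rewrite !mem_cat wE'.
  by rewrite !mem_filter s0E andbT; case: ltngtP.
Qed.

Lemma exists_sorted_word : exists2 w, crossing_word w & sorted geq_lev w.
Proof.
have [w [uw wE sw rw]] := sorted_word_above (leq0n d).
by exists w => //; split=> // h; rewrite wE.
Qed.

(** A gallery to the opposite chamber crosses every hyperplane, so its word has at least [n]
    letters. The sorted word attains [n], so a shortest word repeats no letter. *)
Lemma min_galleryP r : min_gallery a c0 (chamb_opp c0) r <->
  exists2 w, crossing_word w & r = word_gallery c0 w.
Proof.
split=> [[gr rmin]|[w cw ->]].
  have [w [rE aw chw]] := gallery_word gr; exists w => //.
  have [w0 cw0 _] := exists_sorted_word.
  have := rmin _ (crossing_word_gallery cw0).
  rewrite rE /= !size_scanl ltnS (size_crossing_word cw0) -{2}[n]size_enum_ord => wn.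
  have uw : uniq w by apply: (leq_size_uniq (enum_uniq 'I_n)) wn => h _; apply: aw.
  by split=> // m; apply/(chamber_foldl (take_uniq m uw)).
split=> [|r' /gallery_word[w' [-> aw' _]]]; first exact: crossing_word_gallery.
rewrite /= !size_scanl ltnS (size_crossing_word cw) -[X in (X <= _)%N]size_enum_ord.
by apply: uniq_leq_size (enum_uniq _) _ => h _; apply: aw'.
Qed.

Lemma sorted_wordP w : crossing_word w ->
  sorted geq_lev w <-> forall h h', (lev h' < lev h)%N -> (index h w < index h' w)%N.
Proof.
move=> [uw aw _]; split=> [sw h h' lt_lev|lt_ind].
  rewrite ltn_neqAle leqNgt; apply/andP; split.
    by apply: contraTneq lt_lev => /(index_inj h (aw h) (aw h'))->; rewrite ltnn.
  by apply: contraL lt_lev => /(sorted_ltn_index geq_lev_trans sw); rewrite -leqNgt; apply; apply: aw.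
apply/pairwise_sorted/uniq_pairwise => // h h' _ _ hh'.
by rewrite /geq_lev leqNgt; apply/negP => /lt_ind; rewrite ltnNge ltnW.
Qed.

(** The conditions on [i] and [j] amount to [i <= lev h' < j <= lev h]; the choice [i = lev h'],
    [j = lev h] reaches every pair of distinct levels. *)
Lemma incident_wordP w : crossing_word w ->
  gallery_incident_flag a X (word_gallery c0 w) <-> sorted geq_lev w.
Proof.
move=> cw; rewrite sorted_wordP //; split=> [incw h h' lt_lev|lt_ind i j h h'].
  have := incw (lev h') (lev h) h h'; rewrite !cross_time_word.
  by rewrite -!lev_leq ?leqnn -?ltnNge ?lt_lev ?(ltnW (lev_lt _)) //; apply.
case/andP=> ij jd; rewrite -!lev_leq // ?(ltnW (leq_trans ij jd)) //.
by rewrite !cross_time_word -ltnNge => jh _ h'j; apply: lt_ind; apply: leq_trans jh.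
Qed.

Lemma before_realizable w f f' : crossing_word w -> (index f w < index f' w)%N ->
  exists s, [/\ realizable s, f \in s, f' \notin s &
    forall k, (k \in s) = (index k w <= index f w)%N].
Proof.
move=> [uw aw rw] ff'; exists (take (index f w).+1 w).
by rewrite !in_take // ltnS leqnn -leqNgt; split=> // k; rewrite in_take.
Qed.

(** If [f] and [f'] of equal level were crossed in opposite orders, the hyperplane [k] of
    [modular_side], already crossed in both words, would force both values of [e]. *)
Lemma sorted_word_unique w w' : crossing_word w -> crossing_word w' ->
  sorted geq_lev w -> sorted geq_lev w' -> w = w'.
Proof.
move=> cw cw' /(sorted_wordP cw) sw /(sorted_wordP cw') sw'.
have [uw aw _] := cw; have [uw' aw' _] := cw'.
apply: sorted_index_eq => // [h|f f' _ _ ff']; first by rewrite aw aw'.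
have Nff' : f != f' by apply: contraTneq ff' => ->; rewrite ltnn.
have [/sw'//|/sw|lff'] := ltngtP (lev f') (lev f); first by rewrite ltnNge ltnW.
rewrite ltnNge leq_eqVlt negb_or; apply/andP; split.
  by apply: contra Nff' => /eqP/(index_inj f (aw' f') (aw' f))->.
apply/negP => f'f.
have [k [e [lk _ kP]]] := modular_side Nff' (esym lff').
have [s [rs fs f's ks]] := before_realizable cw ff'.
have [s' [rs' f's' fs' ks']] := before_realizable cw' f'f.
have := kP s rs; rewrite fs (negbTE f's) ks ltnW ?sw // => /(_ isT).
have := kP s' rs'; rewrite f's' (negbTE fs') ks' ltnW ?sw' ?lff' // => /(_ isT).
by case: e {kP}.
Qed.


(** * Removing the first level ascent *)

(** Among the hyperplanes through [hyp a b :&: hyp a x], only [b] has level above [lev x]: with a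
    second one, the flat would contain [X (lev x).+1], and so would [hyp a x]. *)
Lemma pivot_unique (b x : 'I_n) f f' k : (lev x < lev b)%N -> f != f' ->
  lev f = lev x -> lev f' = lev x -> (lev x < lev k)%N ->
  (hyp a f :&: hyp a f' <= hyp a k)%MS -> (hyp a b :&: hyp a x <= hyp a f)%MS ->
  (k == b) = (hyp a b :&: hyp a x <= hyp a f')%MS.
Proof.
move=> xb ff' fx f'x xk sk bxf.
have Nbx : b != x by apply: contraTneq xb => ->; rewrite ltnn.
have Nfb : f != b by apply: contraTneq xb => <-; rewrite fx ltnn.
have XI h h' : (lev x < lev h)%N -> (lev x < lev h')%N ->
    (X (lev x).+1 <= hyp a h :&: hyp a h')%MS.
  by move=> xh xh'; rewrite sub_capmx -!lev_leq ?lev_lt // xh.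
apply/eqP/idP => [kb|bxf'].
  rewrite {k xk}kb in sk.
  apply: submx_trans (capmxSr (hyp a f) (hyp a f')).
  apply: submx_trans (hypI_eq arrA ff' Nfb (capmxSl _ _) sk).
  by rewrite sub_capmx bxf capmxSl.
apply/eqP/negPn/negP => Nkb.
have bxk : (hyp a b :&: hyp a x <= hyp a k)%MS.
  by apply: submx_trans sk; rewrite sub_capmx bxf.
have kbx := hypI_eq arrA Nbx Nkb bxk (capmxSl _ _).
have : (X (lev x).+1 <= hyp a x)%MS.
  exact: submx_trans (XI k b xk xb) (submx_trans kbx (capmxSr _ _)).
by rewrite -lev_leq ?lev_lt // ltnn.
Qed.

(** Stop the chain when only the earlier of [f] and [f'] is crossed. No letter of [t] is [k], by its
    level, so [k] is crossed there exactly when it is in [s]. *)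
Lemma chain_order i s t f f' k e :
  (forall h, h \in s -> i < lev h)%N -> (forall h, h \in t -> lev h = i) ->
  (forall m, realizable (s ++ take m t)) -> f \in t -> f' \in t -> f != f' ->
  (i < lev k)%N ->
  (forall s, realizable s -> (f \in s) != (f' \in s) -> (k \in s) = e (+) (f \in s)) ->
  (k \in s) = e (+) (index f t < index f' t)%N.
Proof.
move=> slev tlev rs ft f't ff' ik kP.
pose m := (maxn (index f t) (index f' t)).
have Nif : index f t != index f' t by apply: contra ff' => /eqP/(index_inj f ft f't)->.
have Ns h : h \in t -> (h \in s) = false.
  by move=> /tlev hi; apply: contraTF isT => /slev; rewrite hi ltnn.
have Nk : (k \in take m t) = false.
  by apply/negP => /mem_take/tlev ki; rewrite ki ltnn in ik.
have := kP _ (rs m); rewrite !mem_cat Nk orbF !(Ns _ ft) !(Ns _ f't) !in_take //= /m.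
case: (ltngtP (index f t) (index f' t)) Nif => // [lt|gt] _.
  by rewrite lt ltnn; apply.
by rewrite gt ltnn; apply.
Qed.

(* The first ascent [x b] of [w] ends a run [fs] of letters of level [lev x].
   Crossing [b] reverses, along the fibre over [X (lev x).+1], exactly the pairs
   of [fs] containing [hyp b :&: hyp x]; these letters therefore end [fs], and
   they can be crossed after [b] instead of before. *)
Lemma ascent_move w : crossing_word w -> ~~ sorted geq_lev w ->
  exists w' (b x : 'I_n), let Y := (hyp a b :&: hyp a x)%MS in
  [/\ crossing_word w', (lev x < lev b)%N,
      (index x w < index b w)%N /\ (index b w' < index x w')%N,
      forall h h', (index h w < index h' w)%N -> (index h' w' < index h w')%N ->
        (Y <= hyp a h)%MS && (Y <= hyp a h')%MS &
      forall h, (Y <= hyp a h)%MS -> h = b \/ lev h = lev x /\ (index b w' < index h w')%N].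
Proof.
move=> cw; have [uw aw rw] := cw.
case/unsorted_ascent => p [x [b [q [wE spx]]]]; rewrite -ltnNge => xb.
set i := lev x in xb; set Y := (hyp a b :&: hyp a x)%MS.
have Nbx : b != x by apply: contraTneq xb => ->; rewrite ltnn.
have id : (i < d)%N by apply: lev_lt.
have bY : (Y <= hyp a b)%MS by apply: capmxSl.
have xY : (Y <= hyp a x)%MS by apply: capmxSr.
pose G h := (Y <= hyp a h)%MS.
move: spx; rewrite (sorted_pairwise geq_lev_trans) => spx.
have px_lev h : h \in rcons p x -> (i <= lev h)%N.
  rewrite mem_rcons inE => /predU1P[-> //|hp].
  by move: spx; rewrite pairwise_rcons => /andP[/allP/(_ h hp)].
(* Levels do not increase along [rcons p x] and end at [i], so the letters of level [i] form a final
   segment. *)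
pose pre := [seq h <- rcons p x | lev h != i]; pose fs := [seq h <- rcons p x | lev h == i].
have pxE : rcons p x = pre ++ fs.
  apply: pairwise_filter_cat.
  apply: (@sub_in_pairwise _ (mem (rcons p x)) _ _ _ _ (allss _) spx) => h h' /= _ h'p hh'.
  apply/implyP => /eqP hi; rewrite eqn_leq px_lev // andbT.
  by rewrite -[X in (_ <= X)%N]hi; apply: hh'.
have wE' : w = (pre ++ fs) ++ b :: q by rewrite wE -pxE cat_rcons.
have pre_lev h : h \in pre -> (i < lev h)%N.
  by rewrite mem_filter ltn_neqAle eq_sym => /andP[-> /px_lev].
have fs_lev h : h \in fs -> lev h = i by rewrite mem_filter => /andP[/eqP].
have xfs : x \in fs by rewrite mem_filter eqxx mem_rcons mem_head.
have [upf /norP[bpf _] _] : [/\ uniq (pre ++ fs), ~~ has (mem (pre ++ fs)) (b :: q) & uniq (b :: q)].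
  by move: uw; rewrite wE' cat_uniq => /and3P.
have [bpre bfs] : b \notin pre /\ b \notin fs by apply/norP; rewrite -mem_cat.
have ufs : uniq fs by move: upf; rewrite cat_uniq => /and3P[].
have x_last f : f \in fs -> f != x -> (index f fs < index x fs)%N.
  rewrite /fs filter_rcons eqxx => fin fx.
  have fin' : f \in [seq h <- p | lev h == i] by move: fin; rewrite mem_rcons inE (negbTE fx).
  rewrite -cats1 index_before // cats1; move: ufs.
  by rewrite /fs filter_rcons eqxx.
have r1 m : realizable (pre ++ take m fs).
  have := rw (size pre + minn m (size fs))%N.
  rewrite wE' -catA takeD drop_size_cat // take_size_cat //.
  by rewrite takel_cat ?geq_minr // take_min take_size.
have r2 : realizable (pre ++ fs ++ [:: b]).
  have := rw (size (pre ++ fs) + 1)%N.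
  by rewrite wE' takeD take_size_cat // drop_size_cat //= take0 -catA.
(* The chain [g] reaches the chamber of [pre ++ fs ++ [:: b]] by crossing [b] first and then the
   letters of [fs] in a new order. *)
have [|g [ug gE gr]] := realizable_chain id r2.
  move=> h; rewrite catA mem_cat -pxE inE => /orP[/px_lev//|/eqP->]; exact: ltnW.
have gfs : g =i fs.
  move=> h; rewrite gE mem_filter !mem_cat inE.
  have [hi|hi] /= := eqVneq (lev h) i; last first.
    by apply/esym/negbTE; apply: contra hi => /fs_lev->.
  have -> : (h \in pre) = false by apply/negP => /pre_lev; rewrite hi ltnn.
  by have -> : (h == b) = false; [apply: contraTF xb => /eqP<-; rewrite hi ltnn | rewrite orbF].
have r3 m : realizable ((b :: pre) ++ take m g).
  apply: realizable_eq (gr m) => h; rewrite !mem_cat mem_filter !mem_cat !inE.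
  congr (_ || _); have [hi|hi] /= := ltnP i (lev h).
    have -> : (h \in fs) = false by apply/negP => /fs_lev hi'; rewrite hi' ltnn in hi.
    by rewrite /= orbC.
  apply/esym/negP => /predU1P[hb|/pre_lev]; last by rewrite ltnNge hi.
  by rewrite hb leqNgt xb in hi.
have glev h : h \in g -> lev h = i by rewrite gfs => /fs_lev.
(* The runs [fs] and [g] start from [pre] and [b :: pre], so [chain_order] gives opposite answers
   exactly when the deciding hyperplane is [b], that is, when [f'] also contains [Y]. *)
have order f f' : f \in fs -> f' \in fs -> f != f' -> G f ->
    (index f g < index f' g)%N = (index f fs < index f' fs)%N (+) G f'.
  move=> ffs f'fs ff' Gf; have fi := fs_lev f ffs; have f'i := fs_lev f' f'fs.
  have [|k [e [ik sk kP]]] := modular_side ff'; first by rewrite fi.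
  rewrite fi in ik.
  have fsE := chain_order pre_lev fs_lev r1 ffs f'fs ff' ik kP.
  have bpre_lev h : h \in b :: pre -> (i < lev h)%N by rewrite inE => /predU1P[->//|/pre_lev].
  have := chain_order bpre_lev glev r3 _ _ ff' ik kP; rewrite !gfs => /(_ ffs f'fs).
  have kG : (k == b) = G f' := pivot_unique xb ff' fi f'i ik sk Gf.
  rewrite inE fsE -kG.
  have [kb|_] := eqVneq k b; last by case: e {kP fsE}; do 2 case: (_ < _)%N.
  by move: fsE; rewrite kb (negbTE bpre); case: e {kP}; do 2 case: (_ < _)%N.
have G_last (t : seq 'I_n) : t =i fs -> uniq t ->
    (forall f f', f \in fs -> f' \in fs -> G f -> ~~ G f' -> ~~ (index f t < index f' t)%N) ->
    t = filter (predC G) t ++ filter G t.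
  move=> tE ut tG; apply: pairwise_filter_cat; apply: uniq_pairwise => // f f' ft f't.
  by apply: contraTT; rewrite negb_imply => /andP[]; apply: tG; rewrite -tE.
(* Otherwise [f], [f'], [x] come in this order in [fs], where [x] is last. Of these pairs only [f],
   [x] is reversed in [g], which would be cyclic: [x] before [f] before [f'] before [x]. *)
have fsG f f' : f \in fs -> f' \in fs -> G f -> ~~ G f' -> ~~ (index f fs < index f' fs)%N.
  move=> ffs f'fs Gf NGf'; apply/negP => lt_ff'.
  have ff' : f != f' by apply: contraNneq NGf' => <-.
  have f'x : f' != x by apply: contraNneq NGf' => ->.
  have lt_f'x := x_last f' f'fs f'x.
  have lt_fx := ltn_trans lt_ff' lt_f'x.
  have fx : f != x by apply: contraTneq lt_fx => ->; rewrite ltnn.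
  have := order f f' ffs f'fs ff' Gf; rewrite lt_ff' (negbTE NGf') /= => g_ff'.
  have := order f x ffs xfs fx Gf; rewrite lt_fx (xY : G x) /= => g_fx.
  have := order x f' xfs f'fs; rewrite eq_sym => /(_ f'x xY).
  rewrite (negbTE NGf') addbF [RHS]ltnNge (ltnW lt_f'x) /= => g_xf'.
  have f'_le_x : (index f' g <= index x g)%N by rewrite leqNgt g_xf'.
  have x_le_f : (index x g <= index f g)%N by rewrite leqNgt g_fx.
  by have := leq_trans f'_le_x x_le_f; rewrite leqNgt g_ff'.
have gG f f' : f \in fs -> f' \in fs -> G f -> ~~ G f' -> ~~ (index f g < index f' g)%N.
  move=> ffs f'fs Gf NGf'; have ff' : f != f' by apply: contraNneq NGf' => <-.
  by rewrite order // (negbTE NGf') addbF; apply: fsG.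
pose f1 := filter (predC G) fs; pose f2 := filter G fs.
pose g1 := filter (predC G) g; pose g2 := filter G g.
have fsE : fs = f1 ++ f2 := G_last fs (fun=> erefl) ufs fsG.
have gE' : g = g1 ++ g2 := G_last g gfs ug gG.
have g1E : g1 =i f1 by move=> h; rewrite mem_filter gfs -mem_filter.
have g2E : g2 =i f2 by move=> h; rewrite mem_filter gfs -mem_filter.
have f2P h : (h \in f2) = G h && (h \in fs) := mem_filter _ _ _.
have uf2 : uniq f2 := filter_uniq _ ufs.
have ug2 : uniq g2 := filter_uniq _ ug.
have sz2 : size g2 = size f2 by apply/perm_size/uniq_perm.
have wE2 : w = (pre ++ f1) ++ (f2 ++ [:: b]) ++ q by rewrite wE' fsE -!catA.
pose w' := (pre ++ f1) ++ (b :: g2) ++ q.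
have blockE : f2 ++ [:: b] =i b :: g2 by move=> h; rewrite mem_cat !inE orbC g2E.
have w'w : perm_eq w' w.
  rewrite wE2 perm_cat2l perm_cat2r perm_sym; apply: uniq_perm => //.
  - by rewrite cats1 rcons_uniq uf2 andbT f2P negb_and bfs orbT.
  - by rewrite /= ug2 andbT g2E f2P negb_and bfs orbT.
have uw' : uniq w' by rewrite (perm_uniq w'w).
(* Prefixes ending before the block are prefixes of [w]; inside the block they are given by [r3],
   since [g1] and [f1] have the same letters; beyond it they have the same letters as prefixes of
   [w]. *)
have cw' : crossing_word w'.
  split=> // [h|m]; first by rewrite (perm_mem w'w).
  have [mA|mA] := leqP m (size (pre ++ f1)).
    have tkA t : take m ((pre ++ f1) ++ t) = take m (pre ++ f1) by rewrite takel_cat.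
    by have := rw m; rewrite wE2 /w' !tkA.
  rewrite take_cat ltnNge (ltnW mA) /=; case: (m - _)%N (subn_gt0 (size (pre ++ f1)) m) => [|j _].
    by rewrite mA.
  have [jg|jg] := leqP j (size g2).
    rewrite /= takel_cat //; apply: realizable_eq (r3 (size g1 + j)%N) => h.
    rewrite gE' takeD take_size_cat // drop_size_cat //.
    by rewrite !mem_cat !inE g1E !orbA; case: (h == b); rewrite ?orbT /= ?orbF.
  have := rw (size (pre ++ f1) + (size (f2 ++ [:: b]) + (j - size g2)))%N.
  rewrite wE2 takeD take_size_cat // drop_size_cat // takeD take_size_cat // drop_size_cat //.
  move=> rwm; apply: realizable_eq rwm => h; rewrite /= take_cat ltnNge (ltnW jg) /=.
  by have := blockE h; rewrite -cat_cons !mem_cat => ->.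
exists w', b, x; split=> //.
- split.
    by rewrite wE' index_before -?wE' // mem_cat xfs orbT.
  rewrite /w' cat_cons index_after //.
  by rewrite mem_cat g2E f2P xfs [G x]xY.
- have blockY h : h \in f2 ++ [:: b] -> (Y <= hyp a h)%MS.
    by rewrite mem_cat f2P inE => /orP[/andP[]|/eqP->].
  move=> h h'; rewrite wE2 => hh' h'h.
  have sz : size (f2 ++ [:: b]) = size (b :: g2) by rewrite size_cat addn1 /= sz2.
  by have /andP[/blockY-> /blockY->] := index_swap_mem blockE sz hh' h'h.
- move=> h Yh; have [->|hb] := eqVneq h b; [by left | right].
  have [hi|hi|hi] := ltngtP (lev h) i.
  + have : (X i <= Y)%MS by rewrite sub_capmx -!(lev_leq _ (ltnW id)) (ltnW xb) leqnn.
    by move/submx_trans/(_ Yh); rewrite -lev_leq ?(ltnW id) // leqNgt hi.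
  + have := submx_trans (hypI_eq arrA Nbx hb Yh bY) xY.
    have : (X i.+1 <= hyp a h :&: hyp a b)%MS by rewrite sub_capmx -!lev_leq ?hi ?xb.
    by move=> Xhb /(submx_trans Xhb); rewrite -lev_leq // ltnn.
  + split=> //; rewrite /w' cat_cons index_after //.
    rewrite mem_cat g2E f2P [G h]Yh /=.
    have [->|hx] := eqVneq h x; first by rewrite xfs.
    suff -> : h \in fs by [].
    (* If [h] were not yet crossed, [b] would decide between [h] and [x]; but [x] is crossed and [h]
       is not, both just before and just after [b]. *)
    apply/negPn/negP => hfs; have [k [e [ik sk kP]]] := modular_side hx hi.
    rewrite hi in ik; have kb : k = b.
      by apply/eqP; rewrite (pivot_unique xb hx hi erefl ik sk Yh).
    have Nhpre : h \notin pre by apply: contraTN isT => /pre_lev; rewrite hi ltnn.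
    have := kP _ r2; rewrite kb !mem_cat !inE (negbTE hb) (negbTE hfs) (negbTE Nhpre) xfs.
    rewrite eqxx !orbT => /(_ isT) e1.
    have := kP _ (r1 (size fs)); rewrite kb take_size !mem_cat (negbTE hfs) (negbTE Nhpre) xfs.
    by rewrite (negbTE bpre) (negbTE bfs) !orbT => /(_ isT); rewrite -e1.
Qed.

(** * The sets [L2] and distances in [G2] *)

Lemma diff_order_wordP w w' (Y : 'M[R]_d) :
  reflect (exists h h', [/\ (Y <= hyp a h)%MS, (Y <= hyp a h')%MS,
      (index h w < index h' w)%N & (index h' w' < index h w')%N])
    (diff_order a (word_gallery c0 w) (word_gallery c0 w') Y).
Proof.
apply: (iffP existsP) => [[h /existsP[h']]|[h [h' [Yh Yh' hh' h'h]]]].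
  by rewrite !cross_time_word => /and4P[]; exists h, h'.
by exists h; apply/existsP; exists h'; rewrite !cross_time_word; apply/and4P.
Qed.

Lemma mem_L2 w w' (Z : 'M[R]_d) : Z \in L2 a (word_gallery c0 w) (word_gallery c0 w') <->
  exists S h h', [/\ Z = <<flat a S>>%MS /\ (\rank (flat a S)).+2 = d,
      (flat a S <= hyp a h)%MS, (flat a S <= hyp a h')%MS,
      (index h w < index h' w)%N & (index h' w' < index h w')%N].
Proof.
rewrite /L2 mem_undup; split.
  case/mapP => S; rewrite mem_filter => /andP[/andP[/eqP rkS]].
  move=> /diff_order_wordP[h [h' [Sh Sh' hh' h'h]]] _ ->.
  by exists S, h, h'.
case=> S [h [h' [[-> rkS] Sh Sh' hh' h'h]]]; apply/mapP; exists S => //.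
rewrite mem_filter mem_enum andbT rkS eqxx; apply/diff_order_wordP.
by exists h, h'.
Qed.

(** A pair ordered differently by [w] and [w''] is ordered by [w'] in one of the two ways, hence
    differently from the other word. *)
Lemma L2_sub w w' w'' : crossing_word w' ->
  {subset L2 a (word_gallery c0 w) (word_gallery c0 w'') <=
    L2 a (word_gallery c0 w) (word_gallery c0 w') ++
    L2 a (word_gallery c0 w') (word_gallery c0 w'')}.
Proof.
move=> [_ aw' _] Z /mem_L2[S [h [h' [SZ Sh Sh' hh' h'h]]]]; rewrite mem_cat.
case: (ltngtP (index h w') (index h' w')) => [lt|lt|/(index_inj h (aw' h) (aw' h')) E].
- by apply/orP; right; apply/mem_L2; exists S, h, h'.
- by apply/orP; left; apply/mem_L2; exists S, h, h'.
- by rewrite E ltnn in hh'.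
Qed.

Lemma L2C w w' : L2 a (word_gallery c0 w) (word_gallery c0 w') =i
  L2 a (word_gallery c0 w') (word_gallery c0 w).
Proof.
by move=> Z; apply/idP/idP => /mem_L2[S [h [h' [SZ Sh Sh' hh' h'h]]]];
  apply/mem_L2; exists S, h', h.
Qed.

Lemma L2_refl w : L2 a (word_gallery c0 w) (word_gallery c0 w) = [::].
Proof.
case E: (L2 _ _ _) => [//|Z s]; have : Z \in Z :: s by rewrite mem_head.
by rewrite -E => /mem_L2[S [h [h' [_ _ _ hh']]]]; rewrite ltnNge ltnW.
Qed.

Lemma L2_triangle w w' w'' : crossing_word w' ->
  (L2card a (word_gallery c0 w) (word_gallery c0 w'') <=
   L2card a (word_gallery c0 w) (word_gallery c0 w') +
   L2card a (word_gallery c0 w') (word_gallery c0 w''))%N.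
Proof.
move=> cw'; rewrite /L2card -size_cat; apply: uniq_leq_size (undup_uniq _) _.
exact: L2_sub.
Qed.

Lemma closer_word w0 w : crossing_word w0 -> sorted geq_lev w0 ->
  crossing_word w -> ~~ sorted geq_lev w ->
  exists w', [/\ crossing_word w', L2card a (word_gallery c0 w') (word_gallery c0 w) = 1%N &
    L2card a (word_gallery c0 w0) (word_gallery c0 w) =
    (L2card a (word_gallery c0 w0) (word_gallery c0 w')).+1].
Proof.
move=> cw0 sw0 cw /(ascent_move cw)[w' [b [x [cw' xb [xbw bxw'] swapY hypY]]]].
have Nbx : b != x by apply: contraTneq xb => ->; rewrite ltnn.
set Y := (hyp a b :&: hyp a x)%MS in swapY hypY.
have subS h : h \in [set b; x] -> (flat a [set b; x] <= hyp a h)%MS.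
  by move=> hS; apply: bigcapmx_inf hS (submx_refl _).
have YE : (flat a [set b; x] :=: Y)%MS.
  apply/eqmxP/andP; split; first by rewrite sub_capmx !subS ?set21 ?set22.
  by apply/sub_bigcapmxP => h /set2P[]->; rewrite ?capmxSl ?capmxSr.
set Z := <<flat a [set b; x]>>%MS.
have rkY : (\rank (flat a [set b; x])).+2 = d by rewrite YE rank_hypI.
have Yb : (flat a [set b; x] <= hyp a b)%MS by rewrite YE capmxSl.
have Yx : (flat a [set b; x] <= hyp a x)%MS by rewrite YE capmxSr.
(* Any exchanged pair consists of hyperplanes through [Y], so a flat of codimension two contained in
   both equals [Y]. *)
have L2w'w : L2 a (word_gallery c0 w') (word_gallery c0 w) = [:: Z].
  apply/perm_small_eq => //; apply: uniq_perm; rewrite ?undup_uniq // => T.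
  rewrite inE; apply/idP/eqP => [/mem_L2[S [h [h' [[-> rkS] Sh Sh' hh' h'h]]]]|->]; last first.
    by apply/mem_L2; exists [set b; x], b, x.
  have /andP[Yh' Yh] := swapY _ _ h'h hh'.
  have Nhh' : h != h' by apply: contraTneq hh' => ->; rewrite ltnn.
  apply/genmxP; rewrite andbC; have SY : (flat a S <= Y)%MS.
    apply: submx_trans (hypI_eq arrA Nbx Nhh' Yh Yh').
    by rewrite sub_capmx Sh.
  have := mxrank_leqif_sup SY; rewrite !YE SY andbT => -[_ <-].
  by rewrite -eqSS -eqSS rkS rank_hypI.
(* Both [w0] and [w'] cross [b] before the other hyperplanes through [Y]. These have level [lev x],
   and the side of [b] fixes the order of any two of them. *)
have L2w0w' : Z \notin L2 a (word_gallery c0 w0) (word_gallery c0 w').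
  apply/negP => /mem_L2[S [h [h' [[/genmxP/eqmxP SE _] Sh Sh' hh' h'h]]]].
  have lt0 := (sorted_wordP cw0).1 sw0.
  have /hypY : (Y <= hyp a h)%MS by rewrite -YE SE.
  have /hypY : (Y <= hyp a h')%MS by rewrite -YE SE.
  move=> [h'b|[h'x bh']] [hb|[hx bh]].
  - by rewrite h'b hb ltnn in hh'.
  - by move: hh'; rewrite h'b ltnNge ltnW // lt0 // hx.
  - by move: h'h; rewrite hb ltnNge ltnW.
  have Nhh' : h != h' by apply: contraTneq hh' => ->; rewrite ltnn.
  have [|k [e [lk sk kP]]] := modular_side Nhh'; first by rewrite hx.
  have Yh : (Y <= hyp a h)%MS by rewrite -YE SE.
  have Yh' : (Y <= hyp a h')%MS by rewrite -YE SE.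
  rewrite hx in lk; have kb : k = b.
    by apply/eqP; rewrite (pivot_unique xb Nhh' hx h'x lk sk Yh).
  have [s [rs hs h's ks]] := before_realizable cw0 hh'.
  have [s' [rs' h's' hs' ks']] := before_realizable cw' h'h.
  have := kP s rs; rewrite hs (negbTE h's) ks kb ltnW ?lt0 ?hx // => /(_ isT).
  have := kP s' rs'; rewrite h's' (negbTE hs') ks' kb ltnW // => /(_ isT).
  by case: e {kP}.
exists w'; split=> //; first by rewrite /L2card L2w'w.
have -> : (L2card a (word_gallery c0 w0) (word_gallery c0 w')).+1 =
    size (Z :: L2 a (word_gallery c0 w0) (word_gallery c0 w')) by [].
apply/perm_size/uniq_perm; rewrite /= ?L2w0w' ?undup_uniq // => T.
rewrite inE; apply/idP/predU1P => [/(L2_sub cw')|[->|]].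
- by rewrite mem_cat L2w'w inE => /orP[|/eqP]; [right | left].
- have : Z \in L2 a (word_gallery c0 w') (word_gallery c0 w) by rewrite L2w'w mem_head.
  move/(L2_sub cw0); rewrite mem_cat L2C => /orP[|//].
  by rewrite (negbTE L2w0w').
- move=> Tw0w'; have /(L2_sub cw) := Tw0w'; rewrite mem_cat => /orP[//|].
  rewrite L2C L2w'w inE => /eqP TZ.
  by rewrite -TZ Tw0w' in L2w0w'.
Qed.

(** Each edge contributes one to the triangle inequality; the bound is strict because [size p]
    counts vertices. *)
Lemma G2walk_size w w' p : crossing_word w' -> G2walk a c0 (word_gallery c0 w) (word_gallery c0 w') p ->
  (L2card a (word_gallery c0 w) (word_gallery c0 w') < size p)%N.
Proof.
move=> cw' [t [-> + + pmin]] => /=; rewrite ltnS.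
elim: t w pmin => [|u t IHt] w pmin /=; first by move=> -> _; rewrite /L2card L2_refl.
move=> tl /andP[/eqP wu ut].
have /min_galleryP[v cv uE] : min_gallery a c0 (chamb_opp c0) u.
  by apply: pmin; rewrite !inE eqxx orbT.
rewrite uE in wu tl ut *; apply: leq_trans (L2_triangle _ _ cv) _.
rewrite wu add1n ltnS; apply: IHt => // g gin; apply: pmin.
by rewrite inE uE gin orbT.
Qed.

(** Induction on the size of [L2]: [closer_word] supplies the last edge, and a word without ascent
    is [w0] by uniqueness. *)
Lemma exists_G2walk w0 w : crossing_word w0 -> sorted geq_lev w0 -> crossing_word w ->
  exists p, G2walk a c0 (word_gallery c0 w0) (word_gallery c0 w) p /\
    size p = (L2card a (word_gallery c0 w0) (word_gallery c0 w)).+1.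
Proof.
move=> cw0 sw0; have [m] := ubnP (L2card a (word_gallery c0 w0) (word_gallery c0 w)).
elim: m w => // m IHm w wm cw; have [sw|nsw] := boolP (sorted geq_lev w).
  rewrite (sorted_word_unique cw cw0 sw sw0) /L2card L2_refl.
  exists [:: word_gallery c0 w0]; split => //; exists [::]; split => // u.
  by rewrite inE => /eqP->; apply/min_galleryP; exists w0.
have [w' [cw' w'w w0w]] := closer_word cw0 sw0 cw nsw.
have [|p [[t [-> tl tp tmin]] sz]] := IHm w' _ cw'; first by rewrite w0w in wm.
exists (word_gallery c0 w0 :: rcons t (word_gallery c0 w)); split.
  exists (rcons t (word_gallery c0 w)); split; rewrite ?last_rcons //.
    by rewrite rcons_path tp tl w'w eqxx.
  move=> u; rewrite -rcons_cons mem_rcons inE => /predU1P[->|/tmin//].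
  by apply/min_galleryP; exists w.
by move: sz; rewrite w0w /= size_rcons => -[->].
Qed.

End Flag.

Theorem theorem4p8 (R : realFieldType) (d n : nat) (a : 'I_n -> 'rV[R]_d)
  (X : nat -> 'M[R]_d) (c0 : chamb n) :
  arrangement a -> essential a -> supersolvable a ->
  modular_flag a X ->
  is_chamber a c0 -> chamber_incident_flag a X c0 ->
  (exists! r0, min_gallery a c0 (chamb_opp c0) r0 /\ gallery_incident_flag a X r0) /\
  (forall r0, min_gallery a c0 (chamb_opp c0) r0 -> gallery_incident_flag a X r0 ->
     L2_accessible a c0 r0).
Proof.
move=> arrA _ _ flagX chc0 incX; have minP := min_galleryP arrA flagX chc0 incX.
have incP := incident_wordP arrA flagX.
split.
  have [w0 cw0 sw0] := exists_sorted_word arrA flagX chc0 incX.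
  exists (word_gallery c0 w0); split.
    by split; [apply/minP; exists w0 | apply/incP].
  move=> r [/minP[w cw ->] /(incP _ _ cw) sw].
  by rewrite (sorted_word_unique arrA flagX incX cw0 cw sw0 sw).
move=> r0 /minP[w0 cw0 ->] /(incP _ _ cw0) sw0 r /minP[w cw ->]; split.
  exact: (exists_G2walk arrA flagX chc0 incX cw0 sw0 cw).
by move=> p; apply: (G2walk_size arrA flagX chc0 incX cw).
Qed.
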